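(* Let $n\ge1$ and let $\mathrm{Mon}\subset\mathrm{GL}_{2^n}(\mathbb{C})$ be the monodromy group of Lauricella's system $E_C(a,b,c)$ with parameters $a=b=\tfrac12$, $c_1=\cdots=c_n=1$, generated by the matrices $M_0,\dots,M_n$ given in the context. Then the Zariski closure of $\mathrm{Mon}$ is $\mathrm{Sp}_{2^n}(\mathbb{C})$ if $n$ is odd, and $\mathrm{O}_{2^n}(\mathbb{C})$ if $n$ is even (i.e. the full isometry group of some nondegenerate alternating, respectively symmetric, bilinear form on $\mathbb{C}^{2^n}$).
   Context: Let $\mathbf{e}_0,\mathbf{e}_1$ be the standard basis of $\mathbb{C}^2$, identify $\mathbb{C}^{2^n}$ with $(\mathbb{C}^2)^{\otimes n}$, with basis $\mathbf{e}_I=\mathbf{e}_{i_1}\otimes\cdots\otimes\mathbf{e}_{i_n}$, $I=(i_1,\dots,i_n)\in\{0,1\}^n$, and put $|I|=i_1+\cdots+i_n$. For $k=1,\dots,n$, $M_k$ is the linear map acting on the $k$-th tensor factor by $\begin{pmatrix}1&-1\\0&1\end{pmatrix}$ (so $\mathbf{e}_0\mapsto\mathbf{e}_0$, $\mathbf{e}_1\mapsto-\mathbf{e}_0+\mathbf{e}_1$) and trivially on the other factors. The map $M_0$ is defined by $M_0\mathbf{e}_I=\mathbf{e}_I-v_I\,\mathbf{e}_{1,\dots,1}$, where $v_{(0,\dots,0)}=(-1)^n\cdot4$ and $v_I=(-1)^{n+|I|}\bigl(1+(-1)^{|I|}\bigr)$ for $I\neq(0,\dots,0)$. $\mathrm{Mon}$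 is the group generated by $M_0,M_1,\dots,M_n$. *)

(* Defs.v *)
Set Warnings "-notation-overridden,-ambiguous-paths,-notation-incompatible-prefix".

From mathcomp Require Import all_boot all_order all_algebra.
From mathcomp Require Import reals complex mpoly.

Set Implicit Arguments.
Unset Strict Implicit.
Unset Printing Implicit Defensive.

Import GRing.Theory.
Local Open Scope ring_scope.

(* Basis vectors of F^(2^n) are numbered so that e_r is the Kronecker product
   of the e_(i_k), the first factor being the most significant binary digit.
   [mindex r] is the multi-index I = (i_1, ..., i_n) of e_r. *)
Definition mindex (n : nat) (r : 'I_(2 ^ n)) : {ffun 'I_n -> bool} :=
  [ffun k : 'I_n => odd (r %/ 2 ^ rev_ord k)].

Lemma digits_inj n (a b : nat) : (a < 2 ^ n)%N -> (b < 2 ^ n)%N ->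
  (forall k, (k < n)%N -> odd (a %/ 2 ^ k) = odd (b %/ 2 ^ k)) -> a = b.
Proof.
elim: n a b => [|n IHn] a b; first by rewrite !ltnS !leqn0 => /eqP-> /eqP->.
rewrite !expnS => lta ltb eqd.
have /= eq0 := eqd 0%N isT; rewrite !divn1 in eq0.
rewrite -[a]odd_double_half -[b]odd_double_half eq0 -!divn2.
congr (_ + _.*2)%N; apply: IHn; rewrite ?ltn_divLR 1?mulnC //.
by move=> k ltkn; rewrite -!divnMA -expnS eqd.
Qed.

Lemma mindex_bij n : bijective (@mindex n).
Proof.
apply: inj_card_bij => [r s eqI|].
  apply: val_inj; apply: (@digits_inj n) => [||k ltkn]; try exact: ltn_ord.
  have /ffunP/(_ (rev_ord (Ordinal ltkn))) := eqI.
  by rewrite !ffunE rev_ordK.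
by rewrite card_ffun card_bool !card_ord.
Qed.

Section Generators.
Variables (F : fieldType) (n : nat).
Implicit Types (I : {ffun 'I_n -> bool}) (r s : 'I_(2 ^ n)).

(* Matrices act on column vectors: column s of a matrix is the image of e_s. *)

(* The entries of ((1, -1), (0, 1)). *)
Definition unip2 (i j : bool) : F :=
  match i, j with
  | false, false => 1 | false, true => -1
  | true,  false => 0 | true,  true => 1
  end.

(* id * ... * unip2 * ... * id (Kronecker product), unip2 in position k;
   k : 'I_n is 0-based. *)
Definition Mfactor (k : 'I_n) : 'M[F]_(2 ^ n) :=
  \matrix_(r, s) \prod_(l < n)
    (if l == k then unip2 (mindex r l) (mindex s l)
     else (mindex r l == mindex s l)%:R).

Definition mweight I : nat := \sum_(k < n) I k.

Definition vcoef I : F :=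
  if I == [ffun=> false] then (-1) ^+ n * 4
  else (-1) ^+ (n + mweight I) * (1 + (-1) ^+ mweight I).

Definition Mzero : 'M[F]_(2 ^ n) :=
  \matrix_(r, s)
    ((r == s)%:R - vcoef (mindex s) * (mindex r == [ffun=> true])%:R).

Definition Mon_generator (A : 'M[F]_(2 ^ n)) : Prop :=
  A = Mzero \/ exists k : 'I_n, A = Mfactor k.

End Generators.

(* The subgroup of GL_m generated by S, for S contained in GL_m. *)
Inductive generated (F : fieldType) (m : nat) (S : 'M[F]_m -> Prop) :
    'M[F]_m -> Prop :=
| generated_base A of S A : generated S A
| generated_one : generated S 1%:M
| generated_mul A B of generated S A & generated S B : generated S (A *m B)
| generated_inv A of generated S A : generated S (invmx A).

Definition Mon (F : fieldType) (n : nat) : 'M[F]_(2 ^ n) -> Prop :=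
  generated (@Mon_generator F n).

Section Zariski.
Variables (F : fieldType) (m : nat).

Definition eval_entries (p : {mpoly F[m * m]}) (A : 'M[F]_m) : F :=
  p.@[fun i => mxvec A 0 i].

(* Closed subsets of GL_m. Polynomials in the entries suffice: a regular
   function on GL_m becomes one after multiplication by a power of det. *)
Definition zariski_closed (Z : 'M[F]_m -> Prop) : Prop :=
  exists P : {mpoly F[m * m]} -> Prop,
    forall A, Z A <->
      A \in unitmx /\ (forall p, P p -> eval_entries p A = 0).

(* Closure in GL_m of S, for S contained in GL_m. *)
Definition zariski_closure (S : 'M[F]_m -> Prop) (A : 'M[F]_m) : Prop :=
  forall Z, zariski_closed Z -> (forall B, S B -> Z B) -> Z A.

End Zariski.

Definition alternating (F : fieldType) (m : nat)
    (f : 'cV[F]_m -> 'cV[F]_m -> F) : Prop :=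
  forall u, f u u = 0.

Definition isometry_group (F : fieldType) (m : nat) (eps : bool)
    (f : {hermitian 'cV[F]_m for eps & idfun}) (A : 'M[F]_m) : Prop :=
  A \in unitmx /\ isometry f f (mulmx A).

(* Main.v *)
From HB Require Import structures.
Require Import Defs.
From mathcomp Require Import all_boot all_order all_algebra.
From mathcomp Require Import reals complex mpoly.
From mathcomp Require Import ring.

(** Identify C^(2^n) with C[X_1, ..., X_n] / (X_1^2, ..., X_n^2), e_(1,...,1)
    being 1; then M_k is the multiplication by 1 + X_k, and M_0 is
    x |-> x - f(1, x) 1 for a nondegenerate form f, invariant under every
    product of the maps 1 + t_k X_k and of sign (-1)^n.  So M_0 is a symplectic
    transvection for n odd and an orthogonal reflection for n even.

    The Zariski closure G of Mon contains the integral powers of M_k, hence all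
    the maps 1 + t X_k (t in C), hence the transvections or reflections in the
    vectors u_t = (1 + t_1 X_1) ... (1 + t_n X_n), which span the space.  The set
    of vectors w whose transvections (reflection) lie in G is Zariski closed.
    If it contains w then it contains w + c u_t: for generic t, the line joining
    w to u_t meets it in infinitely many points.  Hence it is the whole space,
    and G is the isometry group of f because transvections generate Sp and
    reflections generate O (Cartan-Dieudonne). *)

Set Implicit Arguments.
Unset Strict Implicit.
Unset Printing Implicit Defensive.

Import Order.TTheory GRing.Theory Num.Theory.
Local Open Scope ring_scope.

(** * Zariski density and Zariski closures *)

Section PolynomialFunctions.
Variable F : fieldType.
Implicit Types (a b : F -> F) (P : F -> Prop).

Definition polyfun a := exists p : {poly F}, forall s, a s = p.[s].

Lemma eq_polyfun a b : a =1 b -> polyfun b -> polyfun a.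
Proof. by move=> eab [p bE]; exists p => s; rewrite eab bE. Qed.

Lemma polyfun_cst c : polyfun (fun=> c).
Proof. by exists c%:P => s; rewrite hornerC. Qed.

Lemma polyfun_id : polyfun id.
Proof. by exists 'X => s; rewrite hornerX. Qed.

Lemma polyfunD a b : polyfun a -> polyfun b -> polyfun (fun s => a s + b s).
Proof. by move=> [p aE] [q bE]; exists (p + q) => s; rewrite hornerD aE bE. Qed.

Lemma polyfunM a b : polyfun a -> polyfun b -> polyfun (fun s => a s * b s).
Proof. by move=> [p aE] [q bE]; exists (p * q) => s; rewrite hornerM aE bE. Qed.

Lemma polyfunN a : polyfun a -> polyfun (fun s => - a s).
Proof. by move=> [p aE]; exists (- p) => s; rewrite hornerN aE. Qed.

Lemma polyfunB a b : polyfun a -> polyfun b -> polyfun (fun s => a s - b s).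
Proof. by move=> ha hb; apply: polyfunD => //; apply: polyfunN. Qed.

Lemma polyfunX a k : polyfun a -> polyfun (fun s => a s ^+ k).
Proof. by move=> [p aE]; exists (p ^+ k) => s; rewrite horner_exp aE. Qed.

Lemma polyfun_sum (I : Type) (r : seq I) (Q : pred I) (A : I -> F -> F) :
  (forall i, polyfun (A i)) -> polyfun (fun s => \sum_(i <- r | Q i) A i s).
Proof.
move=> hA; elim: r => [|i r IHr].
  by apply: eq_polyfun (polyfun_cst 0) => s; rewrite big_nil.
case Qi: (Q i).
  by apply: eq_polyfun (polyfunD (hA i) IHr) => s; rewrite big_cons Qi.
by apply: eq_polyfun IHr => s; rewrite big_cons Qi.
Qed.

Lemma polyfun_prod (I : Type) (r : seq I) (Q : pred I) (A : I -> F -> F) :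
  (forall i, polyfun (A i)) -> polyfun (fun s => \prod_(i <- r | Q i) A i s).
Proof.
move=> hA; elim: r => [|i r IHr].
  by apply: eq_polyfun (polyfun_cst 1) => s; rewrite big_nil.
case Qi: (Q i).
  by apply: eq_polyfun (polyfunM (hA i) IHr) => s; rewrite big_cons Qi.
by apply: eq_polyfun IHr => s; rewrite big_cons Qi.
Qed.

Definition polymx m n (A : F -> 'M[F]_(m, n)) :=
  forall i j, polyfun (fun s => A s i j).

Lemma polymx_cst m n (A : 'M[F]_(m, n)) : polymx (fun=> A).
Proof. by move=> i j; apply: polyfun_cst. Qed.

Lemma polymxD m n (A B : F -> 'M[F]_(m, n)) :
  polymx A -> polymx B -> polymx (fun s => A s + B s).
Proof.
move=> hA hB i j; apply: eq_polyfun (polyfunD (hA i j) (hB i j)) => s.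
by rewrite mxE.
Qed.

Lemma polymxZ m n a (A : F -> 'M[F]_(m, n)) :
  polyfun a -> polymx A -> polymx (fun s => a s *: A s).
Proof.
move=> ha hA i j; apply: eq_polyfun (polyfunM ha (hA i j)) => s.
by rewrite mxE.
Qed.

Lemma polymxB m n (A B : F -> 'M[F]_(m, n)) :
  polymx A -> polymx B -> polymx (fun s => A s - B s).
Proof.
move=> hA hB i j; apply: eq_polyfun (polyfunB (hA i j) (hB i j)) => s.
by rewrite !mxE.
Qed.

Lemma polymxM m n p (A : F -> 'M[F]_(m, n)) (B : F -> 'M[F]_(n, p)) :
  polymx A -> polymx B -> polymx (fun s => A s *m B s).
Proof.
move=> hA hB i j; apply: (@eq_polyfun _ (fun s => \sum_k A s i k * B s k j)).
  by move=> s; rewrite mxE.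
by apply: polyfun_sum => k; apply: polyfunM.
Qed.

Lemma polymx_tr m n (A : F -> 'M[F]_(m, n)) :
  polymx A -> polymx (fun s => (A s)^T).
Proof.
by move=> hA i j; apply: eq_polyfun (hA j i) => s; rewrite mxE.
Qed.

(* Zariski density in the affine line. *)
Definition dense P := forall p : {poly F}, (forall s, P s -> p.[s] = 0) -> p = 0.

Lemma dense_sub P Q : (forall s, P s -> Q s) -> dense P -> dense Q.
Proof. by move=> sPQ dP p p0; apply: dP => s /sPQ/p0. Qed.

(** If [p] vanishes where [a] does not, then [p * q], with [q] the polynomial of [a], vanishes on
    all of [P]; since [q] is not zero, [p] is. *)
Lemma dense_neq0 P a s0 :
  dense P -> polyfun a -> a s0 != 0 -> dense (fun s => P s /\ a s != 0).
Proof.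
move=> dP [q aE] as0 p p0.
have : p * q = 0.
  apply: dP => s Ps; rewrite hornerM; have [qs|qs] := eqVneq q.[s] 0.
    by rewrite qs mulr0.
  by rewrite p0 ?mul0r ?aE.
move/eqP; rewrite mulf_eq0 => /orP[/eqP//|/eqP q0].
by rewrite aE q0 horner0 eqxx in as0.
Qed.

Lemma dense_seq P (e : nat -> F) : injective e -> (forall k, P (e k)) -> dense P.
Proof.
move=> injE Pe p p0; apply/eqP/negPn/negP => /max_poly_roots.
move=> /(_ [seq e k | k <- iota 0 (size p)]); rewrite size_map size_iota ltnn.
suff -> : all (root p) [seq e k | k <- iota 0 (size p)].
  by rewrite map_inj_uniq // iota_uniq => /(_ isT isT).
by apply/allP => _ /mapP[k _ ->]; apply/rootP/p0.
Qed.

(** Every monomial of [p] has degree below [msize p], so multiplying by that power of [q] clears all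
    denominators. *)
Lemma meval_clear_denominator k (p : {mpoly F[k]}) (v : F -> 'I_k -> F) q :
    (forall i, polyfun (v^~ i)) -> polyfun q ->
  exists h : {poly F}, forall s, q s != 0 ->
    h.[s] = q s ^+ msize p * p.@[fun i => (q s)^-1 * v s i].
Proof.
move=> hv hq.
have [h hE] : polyfun (fun s => \sum_(m <- msupp p)
    p@_m * (q s ^+ (msize p - mdeg m) * \prod_i v s i ^+ m i)).
  apply: polyfun_sum => m; apply: polyfunM; first exact: polyfun_cst.
  apply: polyfunM; first exact: polyfunX.
  by apply: polyfun_prod => i; apply: polyfunX.
exists h => s qs; rewrite -hE mevalE mulr_sumr [RHS]big_seq [LHS]big_seq.
apply: eq_bigr => m /msize_mdeg_lt/ltnW lem.
under [in RHS]eq_bigr do rewrite exprMn.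
rewrite big_split /= prodrXr -mdegE [RHS]mulrCA; congr (_ * _); rewrite mulrA.
by congr (_ * _); rewrite exprVn expfB_cond ?(negPf qs).
Qed.

End PolynomialFunctions.

Lemma dense_nat (F : numFieldType) :
  dense (fun s : F => exists k : nat, s = k%:R).
Proof.
apply: (@dense_seq _ _ (fun k => k%:R)) => [i j|k]; last by exists k.
exact: (mulrIn (oner_neq0 F)).
Qed.

Lemma dense_all (F : numFieldType) : dense (fun _ : F => True).
Proof. exact: dense_sub (@dense_nat F). Qed.

(** * Zariski closures in the general linear group *)

Section ZariskiClosure.
Variables (F : fieldType) (m : nat) (S : 'M[F]_m -> Prop).
Local Notation G := (zariski_closure S).

Lemma sub_zariski_closure A : S A -> G A.
Proof. by move=> SA Z _ /(_ _ SA). Qed.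

(** An equation of a closed set containing [S], pulled back along the curve and cleared of
    denominators, is a polynomial in [s] that vanishes on the dense set [P], hence everywhere. The
    scalar denominator [q] is there for reflections, which involve the inverse of a norm. *)
Lemma zariski_closure_curve (P : F -> Prop) (A : F -> 'M[F]_m) (q : F -> F) s0 :
    polymx A -> polyfun q -> dense P ->
    (forall s, P s -> q s != 0 /\ G ((q s)^-1 *: A s)) ->
  q s0 != 0 -> A s0 \in unitmx -> G ((q s0)^-1 *: A s0).
Proof.
move=> hA hq dP hP qs0 uA Z [I ZE] SZ; apply/ZE; split=> [|p Ip].
  by rewrite unitmxZ // unitfE invr_eq0.
have hv i : polyfun (fun s => mxvec (A s) 0 i).
  by case/mxvec_indexP: i => i j; apply: eq_polyfun (hA i j) => s; rewrite mxvecE.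
have [h hE] := meval_clear_denominator p hv hq.
have evE s : eval_entries p ((q s)^-1 *: A s)
    = p.@[fun i => (q s)^-1 * mxvec (A s) 0 i].
  by rewrite /eval_entries linearZ; apply: meval_eq => i; rewrite !mxE.
have h0 : h = 0.
  apply: dP => s /hP[qs GA].
  have /ZE[_ /(_ p Ip) ev0] : Z ((q s)^-1 *: A s) by apply: GA => //; exists I.
  by rewrite hE // -evE ev0 mulr0.
move: (hE _ qs0); rewrite h0 horner0 -evE => /esym/eqP.
by rewrite mulf_eq0 expf_eq0 (negPf qs0) andbF => /eqP.
Qed.

Lemma zariski_closure_polycurve (P : F -> Prop) (A : F -> 'M[F]_m) s0 :
    polymx A -> dense P ->
    (forall s, P s -> G (A s)) -> A s0 \in unitmx -> G (A s0).
Proof.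
move=> hA dP hP uA; rewrite -[A s0]scale1r -invr1.
apply: (@zariski_closure_curve P A (fun=> 1)) => //.
- exact: polyfun_cst.
- by move=> s /hP GA; rewrite oner_neq0 invr1 scale1r.
- by rewrite oner_neq0.
Qed.

(** The equations are those of [Z] with the entries of [L *m X *m R], for a generic matrix [X],
    substituted for the variables. *)
Lemma zariski_closed_translate (L R : 'M[F]_m) (Z : 'M[F]_m -> Prop) :
    L \in unitmx -> R \in unitmx -> zariski_closed Z ->
  zariski_closed (fun A => Z (L *m A *m R)).
Proof.
move=> uL uR [I ZE].
pose X : 'M[{mpoly F[m * m]}]_m := \matrix_(i, j) 'X_(mxvec_index i j).
pose Y := map_mx (@mpolyC _ F) L *m X *m map_mx (@mpolyC _ F) R.
pose lq := [tuple mxvec Y 0 i | i < m * m].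
have compE p A : eval_entries (p \mPo lq) A = eval_entries p (L *m A *m R).
  rewrite /eval_entries comp_mpoly_meval; apply: meval_eq => i.
  rewrite tnth_mktuple; case/mxvec_indexP: i => i j; rewrite !mxvecE /Y !mxE.
  rewrite raddf_sum /=; apply: eq_bigr => k _; rewrite mevalM !mxE mevalC.
  congr (_ * _); rewrite raddf_sum /=; apply: eq_bigr => l _.
  by rewrite mevalM !mxE mevalC mevalXU mxvecE.
exists (fun p => exists2 p', I p' & p = p' \mPo lq) => A; split.
  move=> /ZE[]; rewrite !unitmx_mul uL uR andbT => uA ev0; split=> // p [p' Ip' ->].
  by rewrite compE ev0.
move=> [uA ev0]; apply/ZE; rewrite !unitmx_mul uL uR uA; split=> // p Ip.
by rewrite -compE; apply: ev0; exists p.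
Qed.

Hypothesis S_unit : forall A, S A -> A \in unitmx.
Hypothesis S_mul : forall A B, S A -> S B -> S (A *m B).

Lemma zariski_closure_unit A : G A -> A \in unitmx.
Proof.
move=> GA; apply: (GA (fun B => B \in unitmx)) => //.
by exists (fun=> False) => B; split=> [->|[]//]; split.
Qed.

(** The closure is reached one factor at a time: first on the left with the right factor in [S],
    then on the right with the left factor in the closure. *)
Lemma zariski_closure_mul A B : G A -> G B -> G (A *m B).
Proof.
move=> GA GB Z cZ SZ.
have uA := zariski_closure_unit GA.
have GS C D : G C -> S D -> Z (C *m D).
  move=> GC SD; rewrite -[C]mul1mx.
  apply: (GC (fun C => Z (1%:M *m C *m D))).
    by apply: zariski_closed_translate; rewrite ?unitmx1 ?S_unit.
  by move=> E SE; rewrite mul1mx; apply/SZ/S_mul.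
rewrite -[X in Z X]mulmx1; apply: (GB (fun C => Z (A *m C *m 1%:M))).
  by apply: zariski_closed_translate; rewrite ?unitmx1.
by move=> E SE; rewrite mulmx1; apply: GS.
Qed.

End ZariskiClosure.

(** * Transvections and reflections *)

Section Transvections.
Variables (F : fieldType) (m : nat) (J : 'M[F]_m).
Implicit Types (u v w x y : 'cV[F]_m) (A P : 'M[F]_m) (c : F).

Definition bform u v : F := (u^T *m J *m v) 0 0.

Lemma bformDl u v w : bform (u + v) w = bform u w + bform v w.
Proof. by rewrite /bform linearD !mulmxDl mxE. Qed.

Lemma bformDr u v w : bform u (v + w) = bform u v + bform u w.
Proof. by rewrite /bform mulmxDr mxE. Qed.

Lemma bformZl c u v : bform (c *: u) v = c * bform u v.
Proof. by rewrite /bform linearZ -!scalemxAl mxE. Qed.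

Lemma bformZr c u v : bform u (c *: v) = c * bform u v.
Proof. by rewrite /bform -scalemxAr mxE. Qed.

Lemma bformNl u v : bform (- u) v = - bform u v.
Proof. by rewrite -scaleN1r bformZl mulN1r. Qed.

Lemma bformNr u v : bform u (- v) = - bform u v.
Proof. by rewrite -scaleN1r bformZr mulN1r. Qed.

Lemma bformBl u v w : bform (u - v) w = bform u w - bform v w.
Proof. by rewrite bformDl bformNl. Qed.

Lemma bformBr u v w : bform u (v - w) = bform u v - bform u w.
Proof. by rewrite bformDr bformNr. Qed.

Lemma bform0l u : bform 0 u = 0.
Proof. by rewrite -(scale0r u) bformZl mul0r. Qed.

Lemma bform_sumr u (I : Type) (r : seq I) (Q : pred I) (v : I -> 'cV[F]_m) :
  bform u (\sum_(i <- r | Q i) v i) = \sum_(i <- r | Q i) bform u (v i).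
Proof. by rewrite /bform mulmx_sumr summxE. Qed.

Lemma bform_sym e u v : J^T = e *: J -> bform u v = e * bform v u.
Proof.
move=> JT; rewrite /bform -[u^T *m J *m v]trmxK mxE !trmx_mul trmxK JT.
by rewrite -scalemxAl -scalemxAr mulmxA mxE.
Qed.

Lemma mul_bform w u v : w *m (u^T *m J) *m v = bform u v *: w.
Proof. by rewrite -mulmxA [_ *m v]mx11_scalar mul_mx_scalar. Qed.

Lemma bform_neq0 x : J \in unitmx -> x != 0 -> exists y, bform x y != 0.
Proof.
move=> uJ x0; have /rV0Pn[j xj] : x^T *m J != 0.
  apply: contraNneq x0 => /(congr1 (mulmxr (invmx J))) /=.
  by rewrite mulmxK // mul0mx => /(canRL trmxK) ->; rewrite trmx0.
exists (delta_mx j 0).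
suff -> : bform x (delta_mx j 0) = (x^T *m J) 0 j by [].
by rewrite /bform -colE mxE.
Qed.

Definition isom A := A^T *m J *m A = J.

Lemma isom_bform A u v : isom A -> bform (A *m u) (A *m v) = bform u v.
Proof.
by move=> iA; rewrite /bform -[in RHS]iA trmx_mul !mulmxA.
Qed.

Lemma isom1 : isom 1%:M.
Proof. by rewrite /isom trmx1 mul1mx mulmx1. Qed.

Lemma isomM A B : isom A -> isom B -> isom (A *m B).
Proof.
move=> iA iB; rewrite /isom trmx_mul -[RHS]iB -[X in _ = _ *m X *m _]iA.
by rewrite !mulmxA.
Qed.

Lemma isomV A : A \in unitmx -> isom A -> isom (invmx A).
Proof.
move=> uA iA; rewrite /isom -[X in _ *m X *m _]iA !mulmxA -trmx_mul mulmxV //.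
by rewrite trmx1 mul1mx -mulmxA mulmxV // mulmx1.
Qed.

(** A symplectic transvection when the form is alternating; the orthogonal reflection in [w] when
    the form is symmetric and [c] is [2 / bform w w]. *)
Definition transv w c : 'M[F]_m := 1%:M - c *: (w *m (w^T *m J)).

Lemma transvE w c x : transv w c *m x = x - (c * bform w x) *: w.
Proof. by rewrite mulmxBl mul1mx -scalemxAl mul_bform scalerA. Qed.

Lemma transvZ w a c : transv (a *: w) c = transv w (a ^+ 2 * c).
Proof.
rewrite /transv [(a *: w)^T]linearZ /= -!scalemxAl -scalemxAr !scalerA.
by congr (_ - _ *: _); ring.
Qed.

Lemma transv_mul w c c' :
  transv w c *m transv w c' = transv w (c + c' - c * c' * bform w w).
Proof.
have XX : w *m (w^T *m J) *m (w *m (w^T *m J)) = bform w w *: (w *m (w^T *m J)).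
  by rewrite mulmxA mul_bform -scalemxAl.
rewrite /transv mulmxBl mul1mx mulmxBr mulmx1 -scalemxAl -scalemxAr XX !scalerA.
by rewrite -addrA -!opprD -addrA -scalerBl -scalerDl; congr (_ - _ *: _); ring.
Qed.

Lemma transv0 w : transv w 0 = 1%:M.
Proof. by rewrite /transv scale0r subr0. Qed.

Lemma isomP A : (forall u v, bform (A *m u) (A *m v) = bform u v) -> isom A.
Proof.
move=> hA; apply/matrixP => i j; have := hA (delta_mx i 0) (delta_mx j 0).
have E (B : 'M[F]_m) :
    B i j = ((delta_mx i 0 : 'cV_m)^T *m B *m (delta_mx j 0 : 'cV_m)) 0 0.
  by rewrite trmx_delta -rowE -colE !mxE.
by rewrite /bform trmx_mul !E !mulmxA.
Qed.

(** The defect of invariance at [u], [v] is [bform w u * bform w v] times the difference of the two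
    sides of the hypothesis on [c]. *)
Lemma transv_isom e w c : J^T = e *: J ->
  c * (1 + e) = c ^+ 2 * bform w w -> isom (transv w c).
Proof.
move=> JT cE; apply: isomP => u v.
rewrite !transvE !(bformBl, bformBr, bformZl, bformZr) (bform_sym u w JT).
apply/eqP; rewrite -subr_eq0; apply/eqP.
transitivity (bform w u * bform w v * (c ^+ 2 * bform w w - c * (1 + e))); last first.
  by rewrite cE subrr mulr0.
ring.
Qed.

Lemma transv_conj A A' w c : A *m A' = 1%:M -> isom A ->
  A *m transv w c *m A' = transv (A *m w) c.
Proof.
move=> AA' iA; have JA' : J *m A' = A^T *m J by rewrite -[in LHS]iA -!mulmxA AA' mulmx1.
rewrite /transv mulmxBr mulmx1 mulmxBl AA' -scalemxAr -scalemxAl.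
by rewrite trmx_mul -!mulmxA JA'.
Qed.

Lemma transv0l c : transv 0 c = 1%:M.
Proof. by rewrite /transv mul0mx scaler0 subr0. Qed.

(* [transv w c *m A] fixes every vector fixed by [A] when [w = A x - x]. *)
Lemma transv_sub1 A x c (w := A *m x - x) : isom A ->
  transv w c *m A - 1%:M = (1%:M + c *: (w *m (x^T *m J))) *m (A - 1%:M).
Proof.
move=> iA.
have wJA : w^T *m J *m A = - (x^T *m J *m (A - 1%:M)).
  rewrite /w linearB /= trmx_mul !mulmxBl mulmxBr mulmx1 opprB; congr (_ - _).
  by rewrite -!mulmxA (mulmxA A^T) iA.
rewrite mulmxDl mul1mx {1}/transv mulmxBl mul1mx addrAC; congr (_ + _).
by rewrite -!scalemxAl -scalerN -!(mulmxA w) wJA mulmxN opprK.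
Qed.

End Transvections.

(** * Generation of the symplectic and orthogonal groups *)

Section Generation.
Variables (F : fieldType) (m : nat) (J : 'M[F]_m).
Hypothesis unitJ : J \in unitmx.
Local Notation bform := (bform J).
Local Notation transv := (transv J).
Local Notation isom := (isom J).
Implicit Types (u v w x y : 'cV[F]_m) (A P : 'M[F]_m) (c : F).

(** By [transv_sub1] the row space does not grow. It shrinks strictly because [x] is killed by the
    new difference, while [A - 1%:M] sends it to [w]. *)
Lemma rank_transv_fixes A x c (w := A *m x - x) :
    isom A -> w != 0 -> transv w c *m A *m x = x ->
  (\rank (transv w c *m A - 1%:M)%R < \rank (A - 1%:M)%R)%N.
Proof.
move=> iA w0 fixx; apply: rank_ltmx; rewrite ltmxE transv_sub1 // submxMl /=.
apply: contra w0 => /submxP[Y YE].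
have -> : w = (A - 1%:M) *m x by rewrite mulmxBl mul1mx.
by rewrite YE -transv_sub1 // -mulmxA mulmxBl fixx mul1mx subrr mulmx0.
Qed.

Lemma eq_mulmx_cV A B : (forall x, A *m x = B *m x) -> A = B.
Proof.
by move=> AB; apply/matrixP => i j; have /matrixP/(_ i 0) := AB (delta_mx j 0);
   rewrite -!colE !mxE.
Qed.

(** Induction on the rank of [A - 1%:M]. If some [x] is not orthogonal to [A *m x], a transvection
    sends [A *m x] back to [x] and lowers the rank; otherwise a preliminary transvection, which does
    not raise the rank, creates such an [x]. *)
Lemma skew_transv_ind (G : 'M[F]_m -> Prop) :
    J^T = - J -> (forall u, bform u u = 0) ->
    G 1%:M -> (forall w c A, G A -> G (transv w c *m A)) ->
  forall A, A \in unitmx -> isom A -> G A.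
Proof.
move=> JT alt G1 GT.
have skew u v : bform u v = - bform v u.
  by rewrite (@bform_sym _ _ J (-1)) ?mulN1r // scaleN1r.
have isoT w c : isom (transv w c).
  by apply: (@transv_isom _ _ _ (-1)); rewrite ?scaleN1r // alt subrr !mulr0.
have TK w c A : transv w (- c) *m (transv w c *m A) = A.
  by rewrite mulmxA transv_mul alt mulr0 subr0 addNr transv0 mul1mx.
have uT w c : transv w c \in unitmx.
  by apply: (mulmx1_unit (B := transv w (- c)) _).1; have := TK w (- c) 1%:M;
     rewrite opprK mulmx1.
move=> A; have [k] := ubnP (\rank (A - 1%:M)%R); elim: k A => // k IHk A.
have reduce B x : (\rank (B - 1%:M)%R <= k)%N -> B \in unitmx -> isom B ->
    bform x (B *m x) != 0 -> G B.
  move=> rB uB iB xBx; pose w := B *m x - x.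
  have wBx : bform w (B *m x) = - bform x (B *m x) by rewrite bformBl alt sub0r.
  have w0 : w != 0.
    by apply: contra_neq xBx => w0; rewrite -[LHS]opprK -wBx w0 bform0l oppr0.
  pose c := (bform w (B *m x))^-1.
  rewrite -(TK w c B); apply/GT/IHk; rewrite ?unitmx_mul ?uT ?uB //; last exact: isomM.
  apply: leq_trans rB; apply: rank_transv_fixes => //.
  rewrite -mulmxA transvE mulVf ?scale1r; last by rewrite wBx oppr_eq0.
  by rewrite opprB addrC subrK.
(* Here [w] is a nonzero vector of the form [A *m y - y], so that [transv_sub1] controls the rank
   after a transvection along [w]. *)
rewrite ltnS => rA uA iA; have [A1|nA1] := eqVneq A 1%:M; first by rewrite A1.
have [y wn0] : exists y, A *m y - y != 0.
  have : A - 1%:M != 0 by rewrite subr_eq0.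
  case/matrix0Pn => i [j Aij]; exists (delta_mx j 0).
  apply: contraNneq Aij => /(congr1 (fun v : 'cV_m => v i 0)).
  rewrite -[X in _ - X]mul1mx -mulmxBl -colE.
  by rewrite [LHS]mxE [RHS]mxE => ->.
set w := _ - y in wn0.
have [z Awz] : exists z, bform w (A *m z) != 0.
  have [z wz] := bform_neq0 unitJ wn0.
  by exists (invmx A *m z); rewrite mulKVmx.
(* Two nonzero linear forms are simultaneously nonzero at some vector: one of two witnesses, or else
   their sum. *)
have [x [Awx wx]] : exists x, bform w (A *m x) != 0 /\ bform w x != 0.
  have [z' wz'] := bform_neq0 unitJ wn0.
  have [wz|wz] := eqVneq (bform w z) 0; last by exists z.
  have [Awz'|Awz'] := eqVneq (bform w (A *m z')) 0; last by exists z'.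
  by exists (z + z'); rewrite mulmxDr !bformDr wz Awz' add0r addr0.
have [xAx|xAx] := eqVneq (bform x (A *m x)) 0; last exact: reduce xAx.
(* After the transvection along [w], the pairing of [x] with its image is
   [- bform w (A *m x) * bform x w], which is nonzero. *)
rewrite -(TK w 1 A); apply/GT/(reduce _ x).
- by rewrite (leq_trans _ rA) // mxrankS // transv_sub1 // submxMl.
- by rewrite unitmx_mul uT.
- exact: isomM.
- rewrite -mulmxA transvE mul1r bformBr bformZr xAx sub0r oppr_eq0 mulf_neq0 //.
  by rewrite skew oppr_eq0.
Qed.

(** Cartan-Dieudonne, by induction on the codimension of a nondegenerate subspace fixed by [A]: one
    or two reflections bring [A *m v] back to an anisotropic [v] orthogonal to that subspace,
    without disturbing it. *)
Lemma sym_reflection_ind (G : 'M[F]_m -> Prop) :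
    (2 : F) != 0 -> J^T = J ->
    G 1%:M ->
    (forall w A, bform w w != 0 -> G A -> G (transv w (2 / bform w w) *m A)) ->
  forall A, A \in unitmx -> isom A -> G A.
Proof.
move=> two0 JT G1 GT.
have sym u v : bform u v = bform v u.
  by rewrite (@bform_sym _ _ J 1) ?mul1r // scale1r.
pose refl w := transv w (2 / bform w w).
have isoR w : isom (refl w).
  apply: (@transv_isom _ _ _ 1); rewrite ?scale1r //.
  have [->|q0] := eqVneq (bform w w) 0; first by rewrite !(invr0, mulr0, mul0r).
  by field.
have RK w A : bform w w != 0 -> refl w *m (refl w *m A) = A.
  move=> q0; rewrite mulmxA transv_mul.
  have E (q : F) : q != 0 -> 2 / q + 2 / q - 2 / q * (2 / q) * q = 0.
    by move=> q1; field.
  by rewrite E // transv0 mul1mx.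
have uR w : bform w w != 0 -> refl w \in unitmx.
  by move=> q0; apply: (mulmx1_unit (B := refl w) _).1; rewrite -[X in _ *m X]mulmx1 RK.
have fixR w x : bform w x = 0 -> refl w *m x = x.
  by move=> wx; rewrite transvE wx mulr0 scale0r subr0.
(* [P] is the orthogonal projection onto a nondegenerate subspace fixed by [A]. *)
have main k A P : (m - \rank P < k)%N -> P *m P = P -> P^T *m J = J *m P ->
    A \in unitmx -> isom A -> A *m P = P -> G A.
  elim: k A P => // k IHk A P rP PP PJ uA iA AP.
  have adj x y : bform (P *m x) y = bform x (P *m y).
    by rewrite /bform trmx_mul -(mulmxA _ _ J) PJ !mulmxA.
  have [P1|nP1] := eqVneq P 1%:M; first by rewrite P1 mulmx1 in AP; rewrite AP.
  (* The kernel of [P] is nonzero and nondegenerate. If [u] and [v] in it are isotropic and not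
     orthogonal, then [u + v] has norm [2 * bform u v]. *)
  have [v Pv vv] : exists2 v, P *m v = 0 & bform v v != 0.
    have PK x : P *m (x - P *m x) = 0 by rewrite mulmxBr mulmxA PP subrr.
    have [u [v [Pu Pv uv]]] : exists u v, [/\ P *m u = 0, P *m v = 0 & bform u v != 0].
      have : 1%:M - P != 0 by rewrite subr_eq0 eq_sym.
      case/matrix0Pn => i [j Pij]; pose x : 'cV[F]_m := delta_mx j 0.
      have x0 : x - P *m x != 0.
        apply: contraNneq Pij => /(congr1 (fun v : 'cV_m => v i 0)).
        by rewrite -[X in X - _]mul1mx -mulmxBl -colE [LHS]mxE [RHS]mxE => ->.
      have [y xy] := bform_neq0 unitJ x0.
      exists (x - P *m x), (y - P *m y); split; rewrite ?PK //.
      by rewrite bformBr -adj PK bform0l subr0.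
    have [uu|uu] := eqVneq (bform u u) 0; last by exists u.
    have [vv|vv] := eqVneq (bform v v) 0; last by exists v.
    exists (u + v); first by rewrite mulmxDr Pu Pv addr0.
    rewrite bformDl !bformDr uu vv add0r addr0 (sym v u) -mulr2n -mulr_natl.
    by rewrite mulf_neq0.
  have AvP z : bform (A *m v) (P *m z) = 0.
    by rewrite -AP -mulmxA isom_bform // -adj Pv bform0l.
  have vP z : bform v (P *m z) = 0 by rewrite -adj Pv bform0l.
  (* The orthogonal projection onto the sum of the image of [P] and the line of [v]. *)
  pose P' := P + (bform v v)^-1 *: (v *m (v^T *m J)).
  have P'v : P' *m v = v.
    by rewrite mulmxDl Pv add0r -scalemxAl mul_bform scalerA mulVf ?scale1r.
  have PP' : P *m P' = P.
    by rewrite mulmxDr PP -scalemxAr (mulmxA P) Pv mul0mx scaler0 addr0.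
  have vJP : v^T *m J *m P = 0.
    by rewrite -mulmxA -PJ mulmxA -trmx_mul Pv trmx0 mul0mx.
  have P'P : P' *m P = P.
    by rewrite mulmxDl PP -scalemxAl -mulmxA vJP mulmx0 scaler0 addr0.
  have P'P' : P' *m P' = P'.
    by rewrite {2}/P' mulmxDr P'P -scalemxAr (mulmxA P') P'v.
  have P'J : P'^T *m J = J *m P'.
    rewrite /P' linearD linearZ /= !trmx_mul trmxK JT mulmxDl mulmxDr PJ.
    by rewrite -scalemxAl -scalemxAr !mulmxA.
  have rP' : (m - \rank P' < k)%N.
    have rPP' : (\rank P < \rank P')%N.
      apply: rank_ltmx; rewrite ltmxE -{1}PP' submxMl /=.
      apply: contra vv => /submxP[Y YE].
      have PE : P' = P by rewrite -P'P YE -mulmxA PP.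
      by rewrite -P'v PE Pv bform0l.
    by rewrite -ltnS (leq_trans _ rP) // ltnS ltn_sub2l // (leq_trans rPP') ?rank_leq_col.
  have step B : B \in unitmx -> isom B -> B *m P = P -> B *m v = v -> G B.
    move=> uB iB BP Bv; apply: (IHk B P') => //.
    by rewrite mulmxDr BP -scalemxAr (mulmxA B) Bv.
  have fixP w : (forall z, bform w (P *m z) = 0) -> refl w *m P = P.
    by move=> wP; apply: eq_mulmx_cV => x; rewrite -mulmxA fixR.
  (* By the parallelogram identity the norms of [w] and [w'] add up to [4 * bform v v], so they are
     not both isotropic. *)
  pose w := A *m v - v; pose w' := A *m v + v.
  have [ww|ww] := eqVneq (bform w w) 0; last first.
    rewrite -(RK w A) //; apply/GT/step => //.
    - by rewrite unitmx_mul uR.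
    - exact: isomM.
    - by rewrite -mulmxA AP fixP // => z; rewrite bformBl AvP vP subrr.
    rewrite -mulmxA transvE.
    have -> : 2 / bform w w * bform w (A *m v) = 1.
      rewrite mulrAC; apply/(canLR (mulfK ww)); rewrite mul1r.
      rewrite !(bformBl, bformBr) isom_bform // (sym (A *m v) v); ring.
    by rewrite scale1r opprB addrC subrK.
  have w'w' : bform w' w' != 0.
    have : bform w w + bform w' w' = 2 * 2 * bform v v.
      rewrite !(bformBl, bformBr, bformDl, bformDr) isom_bform //; ring.
    by rewrite ww add0r => ->; rewrite !mulf_neq0.
  (* The reflection in [w'] sends [A *m v] to [- v], which the reflection in [v] sends to [v]. *)
  rewrite -(RK w' A) // -(RK v (refl w' *m A)) //; apply/GT => //; apply/GT => //.
  apply: step.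
  - by rewrite !unitmx_mul !uR.
  - by do 2?[apply: isomM] => //.
  - rewrite -!mulmxA AP !fixP // => z; last by rewrite bformDl AvP vP addr0.
  rewrite -!mulmxA [refl w' *m _]transvE.
  have -> : 2 / bform w' w' * bform w' (A *m v) = 1.
    rewrite mulrAC; apply/(canLR (mulfK w'w')); rewrite mul1r.
    rewrite !(bformDl, bformDr) isom_bform // (sym (A *m v) v); ring.
  rewrite scale1r opprD addrA subrr sub0r mulmxN transvE divfK //.
  by rewrite opprB -[2]/(1 + 1) scalerDl scale1r addrK.
move=> A uA iA; apply: (main m.+1 A 0) => //; rewrite ?mulmx0 ?trmx0 ?mul0mx //.
by rewrite ltnS leq_subr.
Qed.

End Generation.

(** * Saturation of the set of transvections in a Zariski closure *)

Lemma polyfun_bform (F : fieldType) m (J : 'M[F]_m) (u v : F -> 'cV[F]_m) :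
  polymx u -> polymx v -> polyfun (fun s => bform J (u s) (v s)).
Proof.
move=> hu hv; apply: polymxM => //; apply: polymxM; last exact: polymx_cst.
exact: polymx_tr.
Qed.

Section Saturation.
Variables (F : numClosedFieldType) (m : nat) (J : 'M[F]_m).
Variables (S : 'M[F]_m -> Prop) (U : 'cV[F]_m -> Prop).
Local Notation G := (zariski_closure S).
Local Notation bform := (bform J).
Local Notation transv := (transv J).
Implicit Types (u v w x y : 'cV[F]_m) (c : F).

Hypothesis S_unit : forall A, S A -> A \in unitmx.
Hypothesis S_mul : forall A B, S A -> S B -> S (A *m B).
Hypothesis S_one : S 1%:M.

Hypothesis U_span : forall Y : 'cV[F]_m -> Prop,
  (forall u v, Y u -> Y v -> Y (u + v)) -> (forall c u, Y u -> Y (c *: u)) ->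
  (forall u, U u -> Y u) -> forall v, Y v.
(** A polynomial condition that fails to vanish at one point of [U] is thereby nonzero at generic
    points of a curve in [U] through any other point. *)
Hypothesis U_curve : forall u v, U u -> U v ->
  exists y : F -> 'cV[F]_m, [/\ polymx y, y 0 = u, y 1 = v & forall s, U (y s)].

Let G_mul A B : G A -> G B -> G (A *m B).
Proof. exact: zariski_closure_mul. Qed.

Let G_one : G 1%:M.
Proof. exact: sub_zariski_closure. Qed.

Lemma polymx_transv (w : F -> 'cV[F]_m) (c : F -> F) :
  polymx w -> polyfun c -> polymx (fun s => transv (w s) (c s)).
Proof.
move=> hw hc; apply: polymxB; first exact: polymx_cst.
apply: polymxZ => //; apply: polymxM => //.
by apply: polymxM; [exact: polymx_tr | exact: polymx_cst].
Qed.

(** * Transvections for an alternating form *)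

Section Skew.
Hypothesis JT : J^T = - J.
Hypothesis alt : forall u, bform u u = 0.
Hypothesis U_transv : forall u, U u -> G (transv u 1).
Hypothesis U_nondeg : forall x, x != 0 -> exists2 u, U u & bform u x != 0.

(** Asking for all [c] makes [W] stable under scaling of [w]. *)
Let W w := forall c, G (transv w c).

Let transvVr w c : transv w c *m transv w (- c) = 1%:M.
Proof. by rewrite transv_mul alt mulr0 subr0 subrr transv0. Qed.

Let isom_transv w c : isom J (transv w c).
Proof.
by apply: (@transv_isom _ _ _ (-1)); rewrite ?scaleN1r // alt subrr !mulr0.
Qed.

Let unit_transv w c : transv w c \in unitmx.
Proof. exact: (mulmx1_unit (transvVr w c)).1. Qed.

(** The powers of [transv u 1] are the [transv u k%:R], and the natural numbers are dense in the
    line. *)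
Let W_U u : U u -> W u.
Proof.
move=> Uu c.
apply: (zariski_closure_polycurve (A := fun s => transv u s) _ (@dense_nat F)) => //.
  by apply: polymx_transv; [exact: polymx_cst | exact: polyfun_id].
move=> _ [k ->]; elim: k => [|k IHk]; first by rewrite transv0.
suff -> : transv u k.+1%:R = transv u k%:R *m transv u 1.
  by apply: G_mul => //; apply: U_transv.
by rewrite transv_mul alt mulr0 subr0 natr1.
Qed.

Let W_scale w c : W w -> W (c *: w).
Proof. by move=> Ww d; rewrite transvZ. Qed.

Let W_curve (P : F -> Prop) (w : F -> 'cV[F]_m) s :
  polymx w -> dense P -> (forall s, P s -> W (w s)) -> W (w s).
Proof.
move=> hw dP Ww c.
apply: (zariski_closure_polycurve (A := fun s => transv (w s) c) _ dP) => //.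
  by apply: polymx_transv => //; exact: polyfun_cst.
by move=> t /Ww.
Qed.

(** A transvection along [y] sends [x] to [x + c *: y], and conjugation by it carries the
    transvections along [x] to those along its image. *)
Let W_add x y c : W x -> W y -> bform y x != 0 -> W (x + c *: y).
Proof.
move=> Wx Wy yx d; pose c' := - (c / bform y x).
suff -> : x + c *: y = transv y c' *m x.
  rewrite -(transv_conj _ d (transvVr y c')) //.
  by apply: G_mul => //; apply: G_mul.
by rewrite transvE /c' mulNr divfK // scaleNr opprK.
Qed.

(** If [u] is orthogonal to [x], [W_add] does not apply. It does at generic points of a curve in [U]
    starting at [u], and closedness of [W] along the curve gives the result at [u]. *)
Let W_addU x u c : W x -> U u -> W (x + c *: u).
Proof.
move=> Wx Uu; have [->|x0] := eqVneq x 0; first by rewrite add0r; apply: W_scale; apply: W_U.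
have [u' Uu' u'x] := U_nondeg x0; have [y [hy <- y1 Uy]] := U_curve Uu Uu'.
apply: (W_curve (w := fun s => x + c *: y s) _ _ (P := fun s => True /\ bform (y s) x != 0)).
- apply: polymxD; first exact: polymx_cst.
  by apply: polymxZ => //; exact: polyfun_cst.
- apply: (@dense_neq0 _ _ (fun s => bform (y s) x) 1); rewrite ?y1 //.
    exact: dense_all.
  by apply: polyfun_bform => //; exact: polymx_cst.
by move=> s [_ ysx]; apply: W_add => //; exact: W_U.
Qed.

(** The vectors [v] by which [W] can be translated form a subspace containing [U], hence the whole
    space; translation then starts from [0], whose transvections are the identity. *)
Lemma zariski_closure_all_transv w c : G (transv w c).
Proof.
suff Y v : forall x, W x -> forall d, W (x + d *: v).
  rewrite -[w]scale1r -[1 *: w]add0r; apply: Y => d.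
  by rewrite transv0l.
elim/U_span: v => [u v Yu Yv x Wx d | d u Yu x Wx e | u Uu x Wx d].
- by rewrite scalerDr addrA; apply: Yv; apply: Yu.
- by rewrite scalerA; apply: Yu.
- exact: W_addU.
Qed.

End Skew.

(** * Reflections for a symmetric form *)

Section Symmetric.
Hypothesis JT : J^T = J.
Hypothesis U_reflection : forall u, U u -> G (transv u 1).
Hypothesis U_norm : forall u, U u -> bform u u = 2.
Hypothesis U_nonconst : forall x u, bform x x != 0 -> U u ->
  exists2 u', U u' & bform x u' != bform x u.
Hypothesis U_nonempty : exists u, U u.

Let refl w := transv w (2 / bform w w).
(** Isotropic vectors, which have no reflection, belong to [W] vacuously. *)
Let W w := bform w w != 0 -> G (refl w).

Let sym u v : bform u v = bform v u.
Proof. by rewrite (@bform_sym _ _ J 1) ?mul1r // scale1r. Qed.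

Let isom_refl w : isom J (refl w).
Proof.
apply: (@transv_isom _ _ _ 1); rewrite ?scale1r //.
have [->|q0] := eqVneq (bform w w) 0; first by rewrite !(invr0, mulr0, mul0r).
by field.
Qed.

Let reflK w : bform w w != 0 -> refl w *m refl w = 1%:M.
Proof.
move=> q0; rewrite transv_mul.
have E (q : F) : q != 0 -> 2 / q + 2 / q - 2 / q * (2 / q) * q = 0.
  by move=> q1; field.
by rewrite E // transv0.
Qed.

Let W_U u : U u -> W u.
Proof. by move=> Uu _; rewrite /refl U_norm // divff ?pnatr_eq0 //; apply: U_reflection. Qed.

Let W_scale w c : W w -> W (c *: w).
Proof.
move=> Ww; rewrite /W bformZl bformZr !mulf_eq0 !negb_or => /and3P[c0 _ q0].
rewrite /refl transvZ bformZl bformZr.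
have -> : c ^+ 2 * (2 / (c * (c * bform w w))) = 2 / bform w w.
  by field; rewrite c0 q0.
exact: Ww.
Qed.

Let W_curve (P : F -> Prop) (w : F -> 'cV[F]_m) s :
  polymx w -> dense P -> (forall s, P s -> W (w s)) -> W (w s).
Proof.
move=> hw dP Ww ws.
have hq : polyfun (fun s => bform (w s) (w s)) by apply: polyfun_bform.
(* The reflection in [w t] multiplied by the norm of [w t], which makes it polynomial in [t]. *)
pose A t := bform (w t) (w t) *: 1%:M - 2 *: (w t *m ((w t)^T *m J)).
have AE t : bform (w t) (w t) != 0 -> (bform (w t) (w t))^-1 *: A t = refl (w t).
  by move=> wt; rewrite scalerBr !scalerA mulVf // scale1r mulrC.
rewrite -AE //.
apply: (@zariski_closure_curve _ _ _ _ A _ s _ hq (dense_neq0 dP hq ws)) => //.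
- apply: polymxB; first by apply: polymxZ => //; exact: polymx_cst.
  apply: polymxZ; first exact: polyfun_cst.
  apply: polymxM => //.
  by apply: polymxM; [exact: polymx_tr | exact: polymx_cst].
- by move=> t [/Ww Wt wt]; split=> //; rewrite AE //; exact: Wt.
have -> : A s = bform (w s) (w s) *: refl (w s).
  by rewrite -AE // scalerA mulfV // scale1r.
rewrite unitmxZ ?unitfE //; exact: (mulmx1_unit (reflK ws)).1.
Qed.

Let W_refl x y : bform y y != 0 -> W y -> W x -> W (refl y *m x).
Proof.
move=> qy Wy Wx; rewrite /W isom_bform; last exact: isom_refl.
move=> qx; rewrite /refl isom_bform; last exact: isom_refl.
rewrite -(transv_conj _ _ (reflK qy)); last exact: isom_refl.
by apply: G_mul; last exact: Wy; apply: G_mul; [exact: Wy | exact: Wx].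
Qed.

(* On the line spanned by [x - r y], the product of the reflections in [x] and
   [y] acts by the square of [r |-> t - 1 / r]; the orbit of [r = t] is
   strictly decreasing, hence infinite. *)
Let W_plane x y k c (t : F := k.+2%:R) : bform x x = 2 -> bform y y = 2 ->
  bform x y = t -> W x -> W y -> W (x + c *: y).
Proof.
move=> qx qy xy Wx Wy.
have two0 : (2 : F) != 0 by rewrite pnatr_eq0.
have reflx v : refl x *m v = v - bform x v *: x.
  by rewrite transvE qx divff // mul1r.
have refly v : refl y *m v = v - bform y v *: y.
  by rewrite transvE qy divff // mul1r.
pose g (r : F) := t - r^-1.
have t2 : 2 <= t by rewrite ler_nat.
(* The bound [2 <= t] keeps the orbit above [1], so that no denominator vanishes along it. *)
have g_gt1 r : 1 < r -> 1 < g r.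
  move=> r1; rewrite ltrBrDr; apply: lt_le_trans t2.
  by rewrite -[2]/(1 + 1) ltrD2l invf_lt1 // (lt_trans ltr01).
have g_homo a b : 1 < a -> a < b -> g a < g b.
  move=> a1 ab; rewrite ltrD2l ltrN2 ltf_pV2 // posrE (lt_trans ltr01) //.
  exact: lt_trans ab.
pose r j := iter j (g \o g) t.
have rS j : r j.+1 = g (g (r j)) by [].
have r_gt1 j : 1 < r j.
  elim: j => [|j IHj]; first by apply: lt_le_trans t2; rewrite ltr1n.
  by rewrite rS; apply/g_gt1/g_gt1.
have r_decr j : r j.+1 < r j.
  elim: j => [|j IHj].
    rewrite rS {1}/g ltrBlDr ltrDl invr_gt0 (lt_trans ltr01) //.
    by apply: g_gt1; apply: (r_gt1 0).
  rewrite rS [in ltRHS]rS; apply: (g_homo) (g_homo _ _ (r_gt1 _) IHj).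
  by apply: g_gt1; apply: r_gt1.
have r_lt i j : (i < j)%N -> r j < r i.
  move: i j; apply: (@homo_ltn _ r (fun a b => b < a)) => // b a d ba db.
  exact: lt_trans db ba.
have r_inj : injective r.
  by move=> i j rij; case: (ltngtP i j) => // /r_lt; rewrite rij ltxx.
have Wr j : W (x - r j *: y).
  elim: j => [|j IHj].
    (* The orbit starts at [r = t] because the reflection in [y] sends [x] to [x - t *: y]. *)
    rewrite /= -xy sym -refly; apply: W_refl => //.
    by rewrite qy.
  have rj0 : r j != 0 by rewrite gt_eqF // (lt_trans ltr01).
  have grj0 : g (r j) != 0 by rewrite gt_eqF // (lt_trans ltr01) // g_gt1.
  pose d := (r j * g (r j))^-1.
  have -> : x - r j.+1 *: y = refl y *m (d *: (refl x *m (x - r j *: y))).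
    rewrite reflx bformBr bformZr qx xy refly.
    have -> : d *: (x - r j *: y - (2 - r j * t) *: x) = x - (g (r j))^-1 *: y.
      have E1 : d * (1 - (2 - r j * t)) = 1.
        have -> : 1 - (2 - r j * t) = r j * g (r j) by rewrite mulrBr mulfV //; ring.
        by rewrite mulVf // mulf_neq0.
      have E2 : d * r j = (g (r j))^-1 by rewrite /d invfM mulrAC mulVf // mul1r.
      rewrite addrAC -{1}[x]scale1r -scalerBl scalerBr !scalerA E1 E2.
      by rewrite scale1r.
    rewrite bformBr bformZr qy sym xy -addrA -opprD -scalerDl.
    by congr (_ - _ *: _); rewrite /= /g; ring.
  by apply: W_refl; rewrite ?qy //; apply: W_scale; apply: W_refl; rewrite ?qx.
(* Infinitely many points of the line through [x] directed by [y] lie in [W], hence all of them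
   do. *)
apply: (W_curve (w := fun s => x + s *: y) (P := fun s => exists j, s = - r j)).
- apply: polymxD; first exact: polymx_cst.
  by apply: polymxZ; [exact: polyfun_id | exact: polymx_cst].
- apply: (@dense_seq _ _ (fun j => - r j)) => [i j /oppr_inj/r_inj//|j].
  by exists j.
by move=> _ [j ->]; rewrite scaleNr.
Qed.

(** After scaling [x] to norm [2], the product of [x] with a point moving on a curve in [U] is a
    nonconstant polynomial. It takes every value [k.+2%:R], for which [W_plane] applies, and the
    corresponding parameters are dense. *)
Let W_addU x u c : bform x x != 0 -> W x -> U u -> W (x + c *: u).
Proof.
wlog qx : x c / bform x x = 2 => [hwlog|_ Wx Uu].
  move=> qx Wx Uu; pose r := sqrtC (bform x x / 2).
  have rr : r ^+ 2 = bform x x / 2 by rewrite sqrtCK.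
  have two0 : (2 : F) != 0 by rewrite pnatr_eq0.
  have r0 : r != 0 by rewrite -sqrf_eq0 rr mulf_neq0 ?invr_eq0.
  have qx' : bform (r^-1 *: x) (r^-1 *: x) = 2.
    rewrite bformZl bformZr mulrA -invfM -expr2 rr; field.
    by rewrite qx.
  have -> : x + c *: u = r *: (r^-1 *: x + (r^-1 * c) *: u).
    by rewrite scalerDr !scalerA mulrA mulfV // !scale1r mul1r.
  by apply: W_scale; apply: hwlog => //; [rewrite qx' | exact: W_scale].
have qx0 : bform x x != 0 by rewrite qx pnatr_eq0.
have [u' Uu' xu'] := U_nonconst qx0 Uu; have [y [hy y0 y1 Uy]] := U_curve Uu Uu'.
have [p pE] : polyfun (fun s => bform x (y s)).
  by apply: polyfun_bform => //; exact: polymx_cst.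
have sz_p : (1 < size p)%N.
  rewrite ltnNge; apply: contra xu' => /size1_polyC p_cst.
  by rewrite -y0 -y1 !pE p_cst !hornerC.
(* The field is algebraically closed; the parameters [e k] are distinct because the values [k.+2%:R]
   are. *)
have /all_sig[e eE] k : {s | root (p - k.+2%:R%:P) s}.
  apply: sigW; apply/closed_rootP; rewrite size_polyDl ?size_polyN.
    by rewrite neq_ltn sz_p orbT.
  by rewrite size_polyC (leq_ltn_trans _ sz_p) // leq_b1.
rewrite -y0; apply: (W_curve (w := fun s => x + c *: y s)
  (P := fun s => exists k : nat, bform x (y s) = k.+2%:R)).
- apply: polymxD; first exact: polymx_cst.
  by apply: polymxZ => //; exact: polyfun_cst.
- have xe k : bform x (y (e k)) = k.+2%:R.
    by apply/eqP; rewrite -subr_eq0 pE; have := eE k; rewrite rootE hornerD hornerN hornerC.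
  apply: (@dense_seq _ _ e) => [i j eij|k]; last by exists k.
  have := xe i; rewrite eij xe => /eqP; rewrite eqr_nat !eqSS => /eqP//.
by move=> s [k xk]; apply: W_plane xk _ _ => //; [exact: U_norm | exact: W_U].
Qed.

Lemma zariski_closure_all_refl w : bform w w != 0 -> G (transv w (2 / bform w w)).
Proof.
have [u0 Uu0] := U_nonempty.
(* For isotropic [x] the condition [W x] carries no information, so it is replaced by the condition
   on a whole line directed by [u0], which always contains anisotropic vectors. *)
pose Q x := forall s, W (x + s *: u0).
suff Y v : forall x, Q x -> forall d, Q (x + d *: v).
  have Q0 : Q 0 by move=> s; rewrite add0r; apply: W_scale; apply: W_U.
  have := Y w 0 Q0 1 0; rewrite add0r scale1r scale0r addr0; exact.
elim/U_span: v => [u v Yu Yv x Wx d | d u Yu x Wx e | u Uu x Qx d].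
- by rewrite scalerDr addrA; apply: Yv; apply: Yu.
- by rewrite scalerA; apply: Yu.
move=> s; pose q s := bform (x + s *: u0) (x + s *: u0).
have [s0 qs0] : exists s0, q s0 != 0.
  (* The second difference of the quadratic polynomial [q] is twice the norm of [u0]. *)
  have E : q 1 + q (-1) - 2 * q 0 = 4.
    rewrite /q scale0r addr0 scaleN1r scale1r.
    rewrite !(bformDl, bformDr, bformNl, bformNr) (U_norm Uu0) (sym x u0); ring.
  have [q1|] := eqVneq (q 1) 0; last by exists 1.
  have [qN1|] := eqVneq (q (-1)) 0; last by exists (-1).
  exists 0; apply: contra_eq_neq E => ->.
  by rewrite q1 qN1 mulr0 subr0 addr0 eq_sym pnatr_eq0.
have hw : polymx (fun s => x + s *: u0).
  apply: polymxD; first exact: polymx_cst.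
  by apply: polymxZ; [exact: polyfun_id | exact: polymx_cst].
apply: (W_curve (w := fun s => x + d *: u + s *: u0) _ (dense_neq0 (@dense_all F) _ qs0)).
- apply: polymxD; first exact: polymx_cst.
  by apply: polymxZ; [exact: polyfun_id | exact: polymx_cst].
- exact: polyfun_bform.
by move=> t [_ qt]; rewrite addrAC; apply: W_addU.
Qed.

End Symmetric.
End Saturation.

(** * The invariant form of the monodromy group *)

Section Kronecker.
Variables (F : fieldType) (n : nat).
Implicit Types (a b : 'I_n -> bool -> bool -> F) (v : 'I_n -> bool -> F).

Definition kron a : 'M[F]_(2 ^ n) :=
  \matrix_(r, s) \prod_k a k (mindex r k) (mindex s k).

Definition kronv v : 'cV[F]_(2 ^ n) := \col_r \prod_k v k (mindex r k).

(** Distributivity, with the multi-indices as choices of one term per factor; the product rules for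
    tensor products all reduce to it. *)
Lemma sum_mindex_prod v :
  \sum_(r < 2 ^ n) \prod_k v k (mindex r k) = \prod_k (v k true + v k false).
Proof.
under [RHS]eq_bigr do rewrite -big_bool.
rewrite bigA_distr_bigA /= (reindex (@mindex n)) //.
exact/onW_bij/mindex_bij.
Qed.

Lemma eq_kron a b : (forall k i j, a k i j = b k i j) -> kron a = kron b.
Proof. by move=> ab; apply/matrixP => r s; rewrite !mxE; apply: eq_bigr. Qed.

Lemma kron_mul a b : kron a *m kron b =
  kron (fun k i j => a k i true * b k true j + a k i false * b k false j).
Proof.
apply/matrixP => r s; rewrite !mxE -(sum_mindex_prod
  (fun k l => a k (mindex r k) l * b k l (mindex s k))).
by apply: eq_bigr => l _; rewrite !mxE big_split.
Qed.

Lemma kron_mulv a v : kron a *m kronv v =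
  kronv (fun k i => a k i true * v k true + a k i false * v k false).
Proof.
apply/matrixP => r s; rewrite !mxE -(sum_mindex_prod
  (fun k l => a k (mindex r k) l * v k l)).
by apply: eq_bigr => l _; rewrite !mxE big_split.
Qed.

Lemma kronv_mul v a : (kronv v)^T *m kron a =
  (kronv (fun k j => v k true * a k true j + v k false * a k false j))^T.
Proof.
apply/matrixP => r s; rewrite !mxE -(sum_mindex_prod
  (fun k l => v k l * a k l (mindex s k))).
by apply: eq_bigr => l _; rewrite !mxE big_split.
Qed.

Lemma tr_kron a : (kron a)^T = kron (fun k i j => a k j i).
Proof. by apply/matrixP => r s; rewrite !mxE. Qed.

Lemma prod_mindex_eq (r s : 'I_(2 ^ n)) :
  \prod_k (mindex r k == mindex s k)%:R = (r == s)%:R :> F.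
Proof.
have [->|rs] := eqVneq r s; first by rewrite big1 // => k _; rewrite eqxx.
have /existsP[k rsk] : [exists k, mindex r k != mindex s k].
  apply: contraNT rs => /existsPn/= rs; apply/eqP/(bij_inj (@mindex_bij n)).
  by apply/ffunP => k; apply/eqP; have := rs k; rewrite negbK.
by rewrite (bigD1 k) //= (negPf rsk) mul0r.
Qed.

Lemma kron_id : kron (fun _ i j => (i == j)%:R) = 1%:M.
Proof. by apply/matrixP => r s; rewrite !mxE prod_mindex_eq. Qed.

End Kronecker.

(** * The form, its symmetry and its nondegeneracy *)

Section MonodromyForm.
Variables (F : fieldType) (n : nat).
Implicit Types (t d : 'I_n -> F) (r s : 'I_(2 ^ n)).

(* The forms on F^2 preserved by [unip2]; e_0 is isotropic and e_1 has norm [c]. *)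
Definition beta (c : F) (i j : bool) : F :=
  match i, j with
  | false, false => 0 | false, true => 1
  | true, false => -1 | true, true => c
  end.

(** Each summand is invariant factor by factor. On the row of e_(1,...,1), [beta 1] and [beta (-1)]
    give the two terms of v_I for nonzero I, and the summand with coefficient 2 only corrects the
    entry at I = (0,...,0) to the exceptional value. *)
Definition Jform : 'M[F]_(2 ^ n) :=
  2 *: kron (fun=> beta 0) + kron (fun=> beta 1) + kron (fun=> beta (-1)).

(* In the model of the header, [flow t] is the multiplication by the product of
   the 1 + t_k X_k, and [uvec t] is u_t, the tensor product of the
   e_1 - t_k e_0; in particular [uvec (fun=> 0)] is e_(1, ..., 1). *)
Definition flow t : 'M[F]_(2 ^ n) :=
  kron (fun k i j => if i == j then 1 else if i then 0 else - t k).

Definition uvec t : 'cV[F]_(2 ^ n) := kronv (fun k i => if i then 1 else - t k).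

Lemma flowD t d : flow t *m flow d = flow (fun k => t k + d k).
Proof.
by rewrite kron_mul; apply: eq_kron => k [] [] /=; ring.
Qed.

Lemma flow0 : flow (fun=> 0) = 1%:M.
Proof. by rewrite -kron_id; apply: eq_kron => k [] [] //=; rewrite oppr0. Qed.

Lemma flowVr t : flow t *m flow (fun k => - t k) = 1%:M.
Proof. by rewrite flowD -flow0; apply: eq_kron => k [] [] //=; rewrite subrr. Qed.

Lemma eq_uvec t d : t =1 d -> uvec t = uvec d.
Proof.
by move=> td; apply/matrixP => r j; rewrite !mxE; apply: eq_bigr => k _; rewrite td.
Qed.

Lemma flow_uvec t d : flow t *m uvec d = uvec (fun k => t k + d k).
Proof.
rewrite kron_mulv; apply/matrixP => r j; rewrite !mxE; apply: eq_bigr => k _.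
by case: (mindex r k) => /=; ring.
Qed.

Lemma isom_flow t : isom Jform (flow t).
Proof.
have E c : (flow t)^T *m kron (fun=> beta c) *m flow t = kron (fun=> beta c).
  by rewrite tr_kron !kron_mul; apply: eq_kron => k [] [] /=; ring.
by rewrite /isom /Jform !(mulmxDr, mulmxDl) -scalemxAr -scalemxAl !E.
Qed.

(** The transpose of [beta c] is the opposite of [beta (- c)], so transposition swaps the last two
    summands up to the sign. *)
Lemma tr_Jform : Jform^T = (-1) ^+ n *: Jform.
Proof.
have E c : (kron (fun=> beta c))^T = (-1) ^+ n *: kron (fun=> beta (- c)) :> 'M[F]_(2 ^ n).
  apply/matrixP => r s; rewrite !mxE.
  have <- : \prod_(k < n) (-1) = (-1) ^+ n :> F by rewrite prodr_const card_ord.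
  rewrite -big_split /=; apply: eq_bigr => k _.
  by case: (mindex r k) (mindex s k) => [] [] /=; ring.
rewrite /Jform !linearD !linearZ /= !E oppr0 opprK addrAC.
by rewrite !scalerA mulrC.
Qed.

Lemma Jform_eq0 r s k : ~~ mindex r k -> ~~ mindex s k -> Jform r s = 0.
Proof.
move=> rk sk; have E c : kron (fun=> beta c) r s = 0 :> F.
  by rewrite mxE (bigD1 k) //= (negPf rk) (negPf sk) mul0r.
move: (E 0) (E 1) (E (-1)); rewrite /Jform !mxE => -> -> ->.
by rewrite mulr0 !addr0.
Qed.

Lemma Jform_compl r s : (forall k, mindex s k = ~~ mindex r k) ->
  Jform r s = 4 * \prod_k (if mindex r k then -1 else 1).
Proof.
move=> rs; have E c : kron (fun=> beta c) r s = \prod_k (if mindex r k then -1 else 1) :> F.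
  by rewrite mxE; apply: eq_bigr => k _; rewrite rs; case: (mindex r k).
move: (E 0) (E 1) (E (-1)); rewrite /Jform !mxE => -> -> ->; ring.
Qed.

Lemma mindex_surj (f : {ffun 'I_n -> bool}) : exists r, mindex r = f.
Proof. by have [g _ gK] := @mindex_bij n; exists (g f). Qed.

Lemma Mfactor_flow k : Mfactor F k = flow (fun l => (l == k)%:R).
Proof.
apply/matrixP => r s; rewrite !mxE; apply: eq_bigr => l _.
have [_|_] := eqVneq l k; case: (mindex r l) (mindex s l) => [] [] //=.
by rewrite oppr0.
Qed.

(** The row of the form at e_(1,...,1) is exactly the list of the coefficients v_I. *)
Lemma Mzero_transv : Mzero F n = transv Jform (uvec (fun=> 0)) 1.
Proof.
have eE r : uvec (fun=> 0) r 0 = (mindex r == [ffun=> true])%:R.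
  rewrite mxE; have [->|rT] := eqVneq (mindex r) _.
    by rewrite big1 // => k _; rewrite ffunE.
  have /existsP[k rk] : [exists k, ~~ mindex r k].
    apply: contraNT rT => /existsPn/= rT; apply/eqP/ffunP => k.
    by rewrite [RHS]ffunE; have := rT k; rewrite negbK.
  by rewrite (bigD1 k) //= (negPf rk) oppr0 mul0r.
have vE : (uvec (fun=> 0))^T *m Jform = \row_s vcoef F (mindex s).
  have E c : (uvec (fun=> 0))^T *m kron (fun=> beta c)
      = \row_s \prod_k (if mindex s k then c else -1).
    rewrite kronv_mul; apply/matrixP => i s; rewrite !mxE; apply: eq_bigr => k _.
    by case: (mindex s k) => /=; ring.
  have cstE : \prod_(k < n) (-1) = (-1) ^+ n :> F by rewrite prodr_const card_ord.
  have weightE (I : {ffun 'I_n -> bool}) :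
      (-1) ^+ Defs.mweight I = \prod_k (if I k then -1 else 1) :> F.
    by rewrite -prodrXr; apply: eq_bigr => k _; case: (I k).
  rewrite /Jform !mulmxDr -scalemxAr !E; apply/rowP => s; rewrite !mxE.
  have -> : \prod_k (if mindex s k then 1 else -1)
      = (-1) ^+ (n + Defs.mweight (mindex s)) :> F.
    rewrite exprD weightE -cstE -big_split; apply: eq_bigr => k _ /=.
    by case: (mindex s k); ring.
  have -> : \prod_k (if mindex s k then -1 else -1) = (-1) ^+ n :> F.
    by rewrite -cstE; apply: eq_bigr => k _; case: ifP.
  rewrite /vcoef; have [sF|sF] := eqVneq (mindex s) _.
    have -> : Defs.mweight (mindex s) = 0%N.
      by rewrite sF /Defs.mweight big1 // => k _; rewrite ffunE.
    rewrite addn0 (eq_bigr (fun=> -1)) => [|k _]; last by rewrite sF ffunE.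
    by rewrite cstE; ring.
  have /existsP[k sk] : [exists k, mindex s k].
    apply: contraNT sF => /existsPn/= sF; apply/eqP/ffunP => k.
    by rewrite [RHS]ffunE; apply: negPf.
  rewrite (bigD1 k) //= sk mul0r mulr0 add0r exprD mulrDr mulr1; congr (_ + _).
  by rewrite -mulrA -expr2 sqrr_sign mulr1.
rewrite /transv vE scale1r; apply/matrixP => r s.
have : (uvec (fun=> 0) *m (\row_s vcoef F (mindex s))) r s
    = vcoef F (mindex s) * (mindex r == [ffun=> true])%:R.
  by rewrite mxE big_ord1 eE [X in _ * X]mxE mulrC.
by case: (uvec _ *m _) => M ME; rewrite mxE -ME !mxE.
Qed.

(** Triangularity for inclusion of multi-indices: in a vector of the kernel, take a nonzero
    coordinate with the most ones and pair with the complementary index. By [Jform_eq0] and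
    maximality all the other terms vanish. *)
Lemma unit_Jform : (4 : F) != 0 -> Jform \in unitmx.
Proof.
move=> four0; rewrite -row_free_unit; apply: inj_row_free => v vJ.
apply/eqP; apply: contraT => /rV0Pn[r0 vr0].
have [r vr max_r] := @arg_maxnP _ r0 (fun r => v 0 r != 0)
  (fun r => #|[set k | mindex r k]|) vr0.
have [s sE] := mindex_surj [ffun k => ~~ mindex r k].
have := congr1 (fun w : 'rV_(2 ^ n) => w 0 s) vJ; rewrite !mxE (bigD1 r) //=.
rewrite big1 => [|l lr].
  rewrite addr0 Jform_compl => [|k]; last by rewrite sE ffunE.
  move/eqP; rewrite !mulf_eq0 (negPf vr) (negPf four0) /=.
  by rewrite prodf_seq_eq0 => /hasP[k _]; case: ifP; rewrite ?oppr_eq0 oner_eq0.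
have [->|vl] := eqVneq (v 0 l) 0; first by rewrite mul0r.
have [|nsub] := boolP ([set k | mindex r k] \subset [set k | mindex l k]).
  move=> sub; have /eqP/setP eqs : [set k | mindex r k] == [set k | mindex l k].
    by rewrite eqEcard sub; apply: max_r.
  case/eqP: lr; apply/(bij_inj (@mindex_bij n))/ffunP => k.
  by have := eqs k; rewrite !inE.
have [k] := subsetPn nsub; rewrite !inE => rk lk.
by rewrite (Jform_eq0 lk) ?mulr0 // sE ffunE rk.
Qed.

(* The coefficients of e_i on the vectors e_1 and e_1 - e_0. *)
Let coef (i b : bool) : F := if i then (~~ b)%:R else (-1) ^+ b.

(** Each tensor factor is expanded on e_1 and e_1 - e_0, and the product is distributed. Hence the
    [uvec] with parameters 0 and 1 span the space. *)
Lemma delta_uvec r : delta_mx r 0 =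
  \sum_(f : {ffun 'I_n -> bool})
     (\prod_k coef (mindex r k) (f k)) *: uvec (fun k => (f k)%:R).
Proof.
apply/matrixP => s j; rewrite ord1 mxE eqxx andbT summxE eq_sym.
rewrite -prod_mindex_eq.
pose E k (b : bool) := coef (mindex r k) b * (if mindex s k then 1 else - b%:R).
transitivity (\prod_k \sum_b E k b).
  apply: eq_bigr => k _; rewrite big_bool /E /coef.
  by case: (mindex r k) (mindex s k) => [] [] /=; ring.
rewrite bigA_distr_bigA; apply: eq_bigr => f _.
by rewrite !mxE -big_split.
Qed.

Lemma sum_coef r :
  \sum_(f : {ffun 'I_n -> bool}) \prod_k coef (mindex r k) (f k) =
  \prod_k (mindex r k)%:R.
Proof.
rewrite -(bigA_distr_bigA (fun k b => coef (mindex r k) b)).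
by apply: eq_bigr => k _; rewrite big_bool /coef; case: (mindex r k) => /=; ring.
Qed.

End MonodromyForm.

(** * The Zariski closure of the monodromy group *)

Section HermitianForm.
Variables (F : fieldType) (m : nat) (J : 'M[F]_m) (eps : bool).
Hypothesis JT : J^T = (-1) ^+ eps *: J.

(** The proof of symmetry is an argument so that the hermitian structure, which depends on it, can
    be attached to this function. *)
Definition hform of J^T = (-1) ^+ eps *: J := bform J.
Local Notation f := (hform JT).

Let hform_bilinear : bilinear_for
  (GRing.Scale.Law.clone _ _ *%R _) (GRing.Scale.Law.clone _ _ (idfun \; *%R) _) f.
Proof.
by split=> [v|u] c x y; rewrite /hform ?(bformDl, bformDr) ?(bformZl, bformZr).
Qed.

HB.instance Definition _ :=
  bilinear_isBilinear.Build F 'cV[F]_m 'cV[F]_m F _ _ f hform_bilinear.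

Let hform_hermitian u v : f u v = (-1) ^+ eps * idfun (f v u).
Proof. exact: bform_sym. Qed.

HB.instance Definition _ :=
  isHermitianSesquilinear.Build F 'cV[F]_m eps idfun f hform_hermitian.

Definition hermitian_hform : {hermitian 'cV[F]_m for eps & idfun} := f.

Lemma nondegenerate_hform : J \in unitmx -> nondegenerate hermitian_hform.
Proof.
move=> uJ; rewrite /nondegenerate -subv0; apply/subvP => x /mem_orthovP xV.
rewrite memv0; apply/negPn/negP => /(bform_neq0 uJ)[y].
by have /eqP := xV y (memvf y); rewrite /= /hform => ->.
Qed.

End HermitianForm.

Lemma isom_unitmx (F : fieldType) m (J A : 'M[F]_m) :
  J \in unitmx -> isom J A -> A \in unitmx.
Proof. by move=> uJ iA; move: uJ; rewrite -iA !unitmx_mul => /andP[]. Qed.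

(** The equations are the entries of the difference between the transformed form and [J], written
    for a generic matrix. *)
Lemma zariski_closed_isom (F : fieldType) m (J : 'M[F]_m) :
  zariski_closed (fun A => A \in unitmx /\ isom J A).
Proof.
pose X : 'M[{mpoly F[m * m]}]_m := \matrix_(i, j) 'X_(mxvec_index i j).
pose Y := X^T *m map_mx (@mpolyC _ F) J *m X - map_mx (@mpolyC _ F) J.
have YE A i j : eval_entries (Y i j) A = (A^T *m J *m A - J) i j.
  pose ev := meval (fun i => mxvec A 0 i).
  have XE : map_mx ev X = A by apply/matrixP => k l; rewrite !mxE /ev mevalXU mxvecE.
  have JE : map_mx ev (map_mx (@mpolyC _ F) J) = J.
    by apply/matrixP => k l; rewrite !mxE /ev mevalC.
  transitivity (map_mx ev Y i j); first by rewrite [RHS]mxE.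
  by rewrite /Y map_mxB !map_mxM -map_trmx XE JE.
exists (fun p => exists i j, p = Y i j) => A; split=> [[uA iA]|[uA YA]].
  by split=> // _ [i [j ->]]; rewrite YE iA subrr mxE.
split=> //; apply/eqP; rewrite -subr_eq0; apply/eqP/matrixP => i j.
by rewrite -YE [RHS]mxE; apply: YA; exists i, j.
Qed.

Lemma cV_sum_delta (F : nzRingType) m (v : 'cV[F]_m) :
  v = \sum_r v r 0 *: delta_mx r 0.
Proof.
apply/matrixP => s j; rewrite ord1 summxE (bigD1 s) //= big1 ?addr0.
  by rewrite !mxE !eqxx mulr1.
by move=> r rs; rewrite !mxE eq_sym (negPf rs) mulr0.
Qed.

(** * Determination of the closure *)

Section Monodromy.
Variables (F : numClosedFieldType) (n : nat).
Hypothesis n_gt0 : (0 < n)%N.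
Local Notation J := (Jform F n).
Local Notation G := (zariski_closure (@Mon F n)).
Local Notation f := (bform J).
Implicit Types (t d : 'I_n -> F).

Let natF_neq0 k : (k.+1%:R : F) != 0.
Proof. by rewrite pnatr_eq0. Qed.

Let uJ : J \in unitmx.
Proof. exact: unit_Jform. Qed.

Lemma eq_flow t d : t =1 d -> flow t = flow d.
Proof. by move=> td; apply: eq_kron => k i j; rewrite td. Qed.

(** A flow, which is an isometry, reduces to e_(1,...,1), where the tensor power of [beta c] takes
    the value [c ^+ n]; the term with [c = 0] disappears because [n] is positive. *)
Lemma norm_uvec t : f (uvec t) (uvec t) = 1 + (-1) ^+ n.
Proof.
have -> : uvec t = flow t *m uvec (fun=> 0).
  by rewrite flow_uvec; apply: eq_uvec => k; rewrite addr0.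
rewrite isom_bform; last exact: isom_flow.
have E c : ((uvec (fun _ : 'I_n => 0))^T *m kron (fun=> beta c) *m uvec (fun=> 0)) 0 0
    = c ^+ n :> F.
  rewrite kronv_mul mxE.
  transitivity (\sum_(r < 2 ^ n) \prod_(k < n) (if mindex r k then c else 0)).
    apply: eq_bigr => r _; rewrite !mxE -big_split; apply: eq_bigr => k _ /=.
    by case: (mindex r k) => /=; ring.
  rewrite (sum_mindex_prod (fun _ b => if b then c else 0)).
  by under eq_bigr do rewrite addr0; rewrite prodr_const card_ord.
rewrite /bform /Jform !(mulmxDr, mulmxDl) -scalemxAr -scalemxAl.
rewrite [LHS]mxE [X in X + _]mxE [X in X + _ + _]mxE !E.
by rewrite expr0n gtn_eqF // mulr0 add0r expr1n.
Qed.

Lemma isom_Mzero : isom J (Mzero F n).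
Proof.
rewrite Mzero_transv; apply: (@transv_isom _ _ _ ((-1) ^+ n)).
  exact: tr_Jform.
by rewrite norm_uvec expr1n.
Qed.

Lemma Mon_isom A : @Mon F n A -> A \in unitmx /\ isom J A.
Proof.
elim=> [B gB||B C _ [uB iB] _ [uC iC]|B _ [uB iB]].
- have iB : isom J B.
    by case: gB => [->|[k ->]]; [exact: isom_Mzero|rewrite Mfactor_flow; exact: isom_flow].
  by split=> //; exact: isom_unitmx iB.
- by rewrite unitmx1; split=> //; exact: isom1.
- by rewrite unitmx_mul uB; split=> //; exact: isomM.
- by rewrite unitmx_inv; split=> //; exact: isomV.
Qed.

Let Mon_unit A : @Mon F n A -> A \in unitmx. Proof. by case/Mon_isom. Qed.
Let Mon_mul A B : @Mon F n A -> @Mon F n B -> @Mon F n (A *m B).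
Proof. exact: generated_mul. Qed.

Let G_mul A B : G A -> G B -> G (A *m B).
Proof. exact: zariski_closure_mul. Qed.
Let G_one : G 1%:M.
Proof. by apply: sub_zariski_closure; apply: generated_one. Qed.

Lemma closure_Mon_isom A : G A -> A \in unitmx /\ isom J A.
Proof.
move=> GA; apply: (GA (fun B => B \in unitmx /\ isom J B)).
  exact: zariski_closed_isom.
exact: Mon_isom.
Qed.

Lemma polymx_flow (t : F -> 'I_n -> F) :
  (forall k, polyfun (t^~ k)) -> polymx (fun s => flow (t s)).
Proof.
move=> ht i j.
apply: (@eq_polyfun _ _ (fun s => \prod_k
  (if mindex i k == mindex j k then 1 else if mindex i k then 0 else - t s k))).
  by move=> s; rewrite mxE.
apply: polyfun_prod => k; case: (mindex i k == mindex j k); first exact: polyfun_cst.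
by case: (mindex i k); [exact: polyfun_cst | exact: polyfunN].
Qed.

Lemma polymx_uvec (t : F -> 'I_n -> F) :
  (forall k, polyfun (t^~ k)) -> polymx (fun s => uvec (t s)).
Proof.
move=> ht i j.
apply: (@eq_polyfun _ _ (fun s => \prod_k (if mindex i k then 1 else - t s k))).
  by move=> s; rewrite mxE.
by apply: polyfun_prod => k; case: (mindex i k); [exact: polyfun_cst | exact: polyfunN].
Qed.

(** The powers of [Mfactor F k] are dense in its one-parameter group, and a general flow is a
    product of flows along the axes. *)
Lemma closure_Mon_flow t : G (flow t).
Proof.
have G_axis k c : G (flow (fun l => c * (l == k)%:R)).
  apply: (zariski_closure_polycurve (A := fun c => flow (fun l => c * (l == k)%:R))
    _ (@dense_nat F)).
  - apply: polymx_flow => l; apply: polyfunM; [exact: polyfun_id | exact: polyfun_cst].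
  - move=> _ [j ->]; elim: j => [|j IHj].
      by rewrite (@eq_flow _ (fun=> 0)) ?flow0 // => l; rewrite mul0r.
    rewrite (@eq_flow _ (fun l => j%:R * (l == k)%:R + (l == k)%:R)); last first.
      by move=> l; rewrite -natr1 mulrDl mul1r.
    rewrite -flowD; apply: G_mul => //; rewrite -Mfactor_flow.
    by apply: sub_zariski_closure; apply: generated_base; right; exists k.
  - exact: (mulmx1_unit (flowVr _)).1.
have G_sum (ks : seq 'I_n) : G (flow (fun l => \sum_(k <- ks) t k * (l == k)%:R)).
  elim: ks => [|k ks IHks].
    by rewrite (@eq_flow _ (fun=> 0)) ?flow0 // => l; rewrite big_nil.
  rewrite (@eq_flow _ (fun l => t k * (l == k)%:R + \sum_(k <- ks) t k * (l == k)%:R)).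
    by rewrite -flowD; apply: G_mul.
  by move=> l; rewrite big_cons.
rewrite (@eq_flow t (fun l => \sum_k t k * (l == k)%:R)) // => l.
by rewrite (bigD1 l) //= eqxx mulr1 big1 ?addr0 // => k kl; rewrite eq_sym (negPf kl) mulr0.
Qed.

(** Conjugate of [Mzero F n] by the flow that carries e_(1,...,1) to [uvec t]. *)
Lemma closure_Mon_transv t : G (transv J (uvec t) 1).
Proof.
have <- : flow t *m uvec (fun=> 0) = uvec t.
  by rewrite flow_uvec; apply: eq_uvec => k; rewrite addr0.
rewrite -(transv_conj _ _ (flowVr t)); last exact: isom_flow.
apply: G_mul; last exact: closure_Mon_flow.
apply: G_mul; first exact: closure_Mon_flow.
rewrite -Mzero_transv; apply: sub_zariski_closure; apply: generated_base.
by left.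
Qed.

Let U (v : 'cV[F]_(2 ^ n)) := exists t, v = uvec t.

Let U_span (Y : 'cV[F]_(2 ^ n) -> Prop) :
  (forall u v, Y u -> Y v -> Y (u + v)) -> (forall c u, Y u -> Y (c *: u)) ->
  (forall u, U u -> Y u) -> forall v, Y v.
Proof.
move=> YD YZ YU v.
have Y0 : Y 0 by rewrite -(scale0r (uvec (fun=> 0))); apply/YZ/YU; exists (fun=> 0).
rewrite [v]cV_sum_delta.
apply: (big_ind Y) => // r _; apply/YZ; rewrite delta_uvec.
by apply: (big_ind Y) => // g _; apply/YZ/YU; exists (fun k => (g k)%:R).
Qed.

Let U_curve u v : U u -> U v ->
  exists y : F -> 'cV[F]_(2 ^ n), [/\ polymx y, y 0 = u, y 1 = v & forall s, U (y s)].
Proof.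
move=> [t ->] [d ->]; exists (fun s => uvec (fun k => t k + s * (d k - t k))); split.
- apply: polymx_uvec => k; apply: polyfunD; first exact: polyfun_cst.
  by apply: polyfunM; [exact: polyfun_id | exact: polyfun_cst].
- by apply: eq_uvec => k; rewrite mul0r addr0.
- by apply: eq_uvec => k; rewrite mul1r addrC subrK.
- by move=> s; eexists.
Qed.

Let vertex (g : {ffun 'I_n -> bool}) : 'cV[F]_(2 ^ n) := uvec (fun k => (g k)%:R).

Let U_vertex g : U (vertex g).
Proof. by exists (fun k => (g k)%:R). Qed.

(** The sum on the right is the coordinate of [v] at e_(1,...,1): by [sum_coef], the coefficients of
    every other basis vector on the vertices add up to zero. *)
Let bform_cst_vertex x c v : (forall g, f x (vertex g) = c) ->
  f x v = c * \sum_r v r 0 * \prod_k (mindex r k)%:R.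
Proof.
move=> xc; rewrite [v in LHS]cV_sum_delta bform_sumr mulr_sumr.
apply: eq_bigr => r _; rewrite bformZr mulrCA; congr (_ * _).
rewrite delta_uvec bform_sumr -sum_coef mulr_sumr; apply: eq_bigr => g _.
by rewrite bformZr xc mulrC.
Qed.

Let U_nondeg x : x != 0 -> exists2 u, U u & f x u != 0.
Proof.
move=> x0; have [/existsP[g gx]|/existsPn/= ux] := boolP [exists g, f x (vertex g) != 0].
  by exists (vertex g).
have [y] := bform_neq0 uJ x0; rewrite (@bform_cst_vertex x 0) ?mul0r ?eqxx //.
by move=> g; have := ux g; rewrite negbK => /eqP.
Qed.

(* If [f x] is constant on the vertices then [x] is proportional to [e_(0, ..., 0)]. *)
Let U_nonconst x u : f x x != 0 -> U u -> exists2 u', U u' & f x u' != f x u.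
Proof.
move=> xx _; have [/existsP[g gx]|/existsPn/= ux] := boolP [exists g, f x (vertex g) != f x u].
  by exists (vertex g).
case/eqP: xx; have {}ux g : f x (vertex g) = f x u.
  by have := ux g; rewrite negbK => /eqP.
rewrite (bform_cst_vertex _ ux); set s := \sum_r _.
suff -> : s = 0 by rewrite mulr0.
have [r0 r0E] := mindex_surj ([ffun=> false] : {ffun 'I_n -> bool}).
(* The product of [x] with e_(0,...,0) is computed twice: it is zero since this vector has no
   coordinate at e_(1,...,1), and by the entries of [J] it is [4 * (-1) ^+ n * s]. So [s] is
   zero. *)
have : f x (delta_mx r0 0) = 0.
  rewrite (bform_cst_vertex _ ux) big1 ?mulr0 // => r _.
  rewrite mxE eqxx andbT; have [->|_] := eqVneq r r0; last by rewrite mul0r.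
  by rewrite (bigD1 (Ordinal n_gt0)) //= r0E ffunE mul0r mulr0.
rewrite /bform -colE mxE mxE.
have -> : \sum_r x^T 0 r * J r r0 = 4 * (-1) ^+ n * s.
  rewrite mulr_sumr; apply: eq_bigr => r _; rewrite mxE mulrCA; congr (_ * _).
  have [/existsP[k rk]|/existsPn/= rT] := boolP [exists k, ~~ mindex r k].
    rewrite (bigD1 k) //= (negPf rk) mul0r mulr0.
    by apply: (Jform_eq0 _ rk); rewrite r0E ffunE.
  have {}rT k : mindex r k by have := rT k; rewrite negbK.
  rewrite Jform_compl => [|k]; last by rewrite r0E ffunE rT.
  rewrite [X in _ = _ * X]big1 => [|k _]; last by rewrite rT.
  rewrite mulr1; congr (_ * _); rewrite -[in RHS](card_ord n) -prodr_const.
  by apply: eq_bigr => k _; rewrite rT.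
by move/eqP; rewrite !mulf_eq0 signr_eq0 (negPf (natF_neq0 3)) => /eqP.
Qed.

Lemma closure_Mon_odd A : odd n -> A \in unitmx -> isom J A -> G A.
Proof.
move=> n_odd; have JT : J^T = - J by rewrite tr_Jform -signr_odd n_odd scaleN1r.
have skew u v : f u v = - f v u.
  by rewrite (bform_sym _ _ (tr_Jform F n)) -signr_odd n_odd mulN1r.
have alt u : f u u = 0.
  apply/eqP; have /eqP := skew u u; rewrite -addr_eq0 -mulr2n mulrn_eq0.
  by [].
apply: skew_transv_ind => // w c B GB; apply: G_mul => //.
apply: (@zariski_closure_all_transv _ _ J _ U) => //.
- exact: generated_one.
- by move=> _ [t ->]; exact: closure_Mon_transv.
- move=> x /U_nondeg[u Uu xu]; exists u => //.
  by rewrite skew oppr_eq0.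
Qed.

Lemma closure_Mon_even A : ~~ odd n -> A \in unitmx -> isom J A -> G A.
Proof.
move=> n_even; have sgn : (-1) ^+ n = 1 :> F by rewrite -signr_odd (negPf n_even).
have JT : J^T = J by rewrite tr_Jform sgn scale1r.
apply: sym_reflection_ind => // w B ww GB; apply: G_mul => //.
apply: (@zariski_closure_all_refl _ _ J _ U) => //.
- by move=> _ [t ->]; exact: closure_Mon_transv.
- by move=> _ [t ->]; rewrite norm_uvec sgn.
- by exists (uvec (fun=> 0)); exists (fun=> 0).
Qed.

Lemma closure_Mon_isometry_group (eps : bool)
    (h : {hermitian 'cV[F]_(2 ^ n) for eps & idfun}) A :
    (h : _ -> _ -> F) =2 bform J -> odd n = eps ->
  G A <-> isometry_group h A.
Proof.
move=> hE n_eps; split=> [/closure_Mon_isom[uA iA]|[uA iA]].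
  by split=> // u v; rewrite !hE isom_bform.
have {}iA : isom J A by apply: isomP => u v; rewrite -!hE iA.
case: (boolP (odd n)) => n_odd; first exact: closure_Mon_odd.
exact: closure_Mon_even.
Qed.

End Monodromy.

Theorem mainTheorem6 (R : realType) (n : nat) (hn : (1 <= n)%N) :
  (odd n ->
     exists f : {skew_symmetric 'cV[R[i]]_(2 ^ n)},
       nondegenerate f /\ alternating f /\
       (forall A : 'M[R[i]]_(2 ^ n),
          zariski_closure (@Mon R[i] n) A <-> isometry_group f A)) /\
  (~~ odd n ->
     exists f : {symmetric 'cV[R[i]]_(2 ^ n)},
       nondegenerate f /\
       (forall A : 'M[R[i]]_(2 ^ n),
          zariski_closure (@Mon R[i] n) A <-> isometry_group f A)).
Proof.
have uJ : Jform R[i] n \in unitmx by apply: unit_Jform; rewrite pnatr_eq0.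
have JT (eps : bool) : odd n = eps -> (Jform R[i] n)^T = (-1) ^+ eps *: Jform R[i] n.
  by move=> <-; rewrite tr_Jform signr_odd.
split=> [n_odd|/negPf n_even].
  exists (hermitian_hform (JT true n_odd)); split; first exact: nondegenerate_hform.
  split=> [u|A]; last exact: closure_Mon_isometry_group.
  rewrite /= /hform; apply/eqP; have /eqP := bform_sym u u (JT true n_odd).
  by rewrite mulN1r -addr_eq0 -mulr2n mulrn_eq0.
exists (hermitian_hform (JT false n_even)); split; first exact: nondegenerate_hform.
move=> A; exact: closure_Mon_isometry_group.
Qed.
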